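(* For a state $s$ let $z_\perp:=(\langle a_\perp,b_\perp\rangle+iA_\perp)/|a_\perp|^2\in\mathbb H$. Then $$m(s)=\cosh d_{\mathbb H}(z_\perp,i).$$ Thus the algorithm, which at each step selects a candidate of minimal $m$, selects a candidate whose point $z_\perp$ is at minimal hyperbolic distance from $i$. Moreover, multiplication of the state by a unit $\lambda$ (i.e. $(u_1,u_2,u_3)\mapsto(\lambda u_1,\lambda u_2,\lambda u_3)$) acts on the pair $(a_\perp,b_\perp)$ by a complex similarity (multiplication of $a_\perp+ib_\perp$ by $\sigma_c(\lambda)$), whose rotation part moves $z_\perp$ by the elliptic isometry of $\mathbb H$ fixing $i$ with rotation angle twice the argument of $\sigma_c(\lambda)$, up to orientation. In particular $d_{\mathbb H}(z_\perp,i)$, hence $m$, is invariant under multiplication by units, while the point $z_\perp$ itself is fixed only when $\sigma_c(\lambda)$ is real.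
   Context: $K$ is a cubic number field of signature $(1,1)$, with real embedding $\sigma_r$ and complex embedding $\sigma_c$; $L\subset\mathcal O_K$ is an order. A state is an ordered triple $s=(u_1,u_2,u_3)$ of elements of $L$ forming a $\mathbb Q$-basis of $K$ with $x_i=\sigma_r(u_i)>0$, sorted so that $x_1\ge x_2\ge x_3>0$. Put $\xi=(x_1,x_2,x_3)$, $\hat\xi=\xi/|\xi|$, $\nu=(\sigma_c(u_1),\sigma_c(u_2),\sigma_c(u_3))=a+ib$ with $a,b\in\mathbb R^3$, $a_\perp=a-\langle a,\hat\xi\rangle\hat\xi$, $b_\perp=b-\langle b,\hat\xi\rangle\hat\xi$, $T=|a_\perp|^2+|b_\perp|^2$, $A_\perp=|a_\perp\times b_\perp|$, and $m(s)=T/(2A_\perp)$ (the conformal module). The same definitions of $a_\perp,b_\perp,z_\perp,m$ are used for $\lambda s$. $\mathbb H$ is the upper half-plane with hyperbolic distance $d_{\mathbb H}$. Algorithm: for $A,B,g\in\mathbb Z_{\ge0}$ the move $V(A,B,g)$ sends $(u_1,u_2,u_3)$ to $(u_1-g(u_2-Bu_3)-Au_3,\ u_2-Bu_3,\ u_3)$, and $W$ sends it to $(u_1-u_2,\ u_2,\ u_3-(u_1-u_2))$. The candidates at $s$ are the images of $s$ under these moves (identity $V(0,0,0)$ excluded) whose new real coordinates are all positive; the algorithm selects a candidate of minimal $m$. *)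

(* Defs.v *)
From HB Require Import structures.
From mathcomp Require Import all_boot all_order all_algebra all_field.
From mathcomp Require Import all_classical all_reals all_analysis.
From mathcomp.real_closed Require Import complex.

Set Implicit Arguments.
Unset Strict Implicit.
Unset Printing Implicit Defensive.

Import Order.TTheory GRing.Theory Num.Theory.
Import numFieldNormedType.Exports.

Local Open Scope classical_set_scope.
Local Open Scope ring_scope.

Section NumberField.
Variables (R : realType) (K : fieldExtType rat).

Definition algint (x : K) : Prop := integralOver (intr : int -> K) x.

Definition algint_unit (x : K) : Prop := [/\ x != 0, algint x & algint x^-1].

Definition is_order (L : {pred K}) : Prop :=
  GRing.subring_closed L /\
  exists b : (\dim {:K}).-tuple K,
    basis_of fullv b /\ forall x, x \in L <-> inIntSpan b x.

(* Up to complex conjugation, [sr] and [sc] are the only real and the only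
   non-real archimedean embeddings of [K]. *)
Definition signature11 (sr : {rmorphism K -> R}) (sc : {rmorphism K -> R[i]}) :
    Prop :=
  [/\ forall f : {rmorphism K -> R}, f =1 sr,
      exists x, sc x \isn't Num.real
    & forall f : {rmorphism K -> R[i]}, (exists x, f x \isn't Num.real) ->
        f =1 sc \/ f =1 (fun x => (sc x)^*)%C].

End NumberField.

Section Euclidean.
Variable R : realType.

(* The library norm [`|v|] on row vectors is the sup norm, so the Euclidean
   one is introduced here. *)
Definition dot n (u v : 'rV[R]_n) : R := \sum_i u 0 i * v 0 i.

Definition enorm n (u : 'rV[R]_n) : R := Num.sqrt (dot u u).

(* Indices are taken in ['I_3], i.e. cyclically modulo 3. *)
Definition cross (u v : 'rV[R]_3) : 'rV[R]_3 :=
  \row_k (u 0 (k + 1) * v 0 (k + 2) - u 0 (k + 2) * v 0 (k + 1)).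

Definition cvec n (a b : 'rV[R]_n) : 'rV[R[i]]_n :=
  \row_k (a 0 k +i* b 0 k)%C.

Definition pair_T (a b : 'rV[R]_3) : R := enorm a ^+ 2 + enorm b ^+ 2.

Definition pair_A (a b : 'rV[R]_3) : R := enorm (cross a b).

Definition pair_z (a b : 'rV[R]_3) : R[i] :=
  (dot a b +i* pair_A a b)%C / ((enorm a ^+ 2)%:C)%C.

End Euclidean.

Section HyperbolicPlane.
Variable R : realType.

Definition cosh (x : R) : R := (expR x + expR (- x)) / 2.

Definition arsinh (x : R) : R := ln (x + Num.sqrt (x ^+ 2 + 1)).

Definition upper_half_plane : set R[i] := [set z | 0 < complex.Im z].

(* Distance of the metric |dz|^2 / (Im z)^2 of curvature -1, through
   sinh (d(z, w) / 2) = |z - w| / (2 sqrt (Im z Im w));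
   [complex.Re `|_|] is the modulus as an element of [R]. *)
Definition hdist (z w : R[i]) : R :=
  2 * arsinh (complex.Re `|z - w| /
              (2 * Num.sqrt (complex.Im z * complex.Im w))).

Definition expi (t : R) : R[i] := (cos t +i* sin t)%C.

(* Elliptic isometry of the upper half-plane fixing i, with rotation angle
   [phi] (counterclockwise): its differential at i is multiplication by
   exp(i phi), so that it preserves orientation.  Values of [g] off the upper
   half-plane are irrelevant.  The identity is included, for [phi] in 2 pi Z. *)
Definition elliptic_at_i (phi : R) (g : R[i] -> R[i]) : Prop :=
  [/\ set_bij upper_half_plane upper_half_plane g,
      forall z w, upper_half_plane z -> upper_half_plane w ->
        hdist (g z) (g w) = hdist z w,
      g 'i%C = 'i%C
    & ((g ('i%C + h) - g 'i%C) / h : R[i]^o)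
        @[h --> (0 : R[i]^o)^'] --> (expi phi : R[i]^o)].

End HyperbolicPlane.

Section States.
Variables (R : realType) (K : fieldExtType rat).
Variables (sr : {rmorphism K -> R}) (sc : {rmorphism K -> R[i]}).
Implicit Types s t : 3.-tuple K.

(* The entries u_1, u_2, u_3 are [tnth s 0], [tnth s 1], [tnth s 2]. *)
Definition xi s : 'rV[R]_3 := \row_k sr (tnth s k).

Definition is_state (L : {pred K}) s : Prop :=
  [/\ all [in L] s, basis_of fullv s
    & [/\ xi s 0 1 <= xi s 0 0, xi s 0 2 <= xi s 0 1 & 0 < xi s 0 2]].

Definition xihat s : 'rV[R]_3 := (enorm (xi s))^-1 *: xi s.

Definition proj_perp s (v : 'rV[R]_3) : 'rV[R]_3 :=
  v - dot v (xihat s) *: xihat s.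

Definition a_perp s : 'rV[R]_3 :=
  proj_perp s (\row_k complex.Re (sc (tnth s k))).

Definition b_perp s : 'rV[R]_3 :=
  proj_perp s (\row_k complex.Im (sc (tnth s k))).

Definition conf_module s : R :=
  pair_T (a_perp s) (b_perp s) / (2 * pair_A (a_perp s) (b_perp s)).

Definition z_perp s : R[i] := pair_z (a_perp s) (b_perp s).

Definition scale_state (lam : K) s : 3.-tuple K := map_tuple ( *%R lam) s.

Definition move_V (A B g : nat) s : 3.-tuple K :=
  let u1 := tnth s 0 in let u2 := tnth s 1 in let u3 := tnth s 2 in
  [tuple u1 - (u2 - u3 *+ B) *+ g - u3 *+ A; u2 - u3 *+ B; u3].

Definition move_W s : 3.-tuple K :=
  let u1 := tnth s 0 in let u2 := tnth s 1 in let u3 := tnth s 2 in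
  [tuple u1 - u2; u2; u3 - (u1 - u2)].

(* Candidates are not re-sorted: all quantities below are insensitive to the
   order of the entries. *)
Definition candidate s t : Prop :=
  ((exists A B g : nat, (A, B, g) <> (0, 0, 0)%N /\ t = move_V A B g s) \/
   t = move_W s) /\
  forall k, 0 < xi t 0 k.

Definition selected s t : Prop :=
  candidate s t /\
  forall t', candidate s t' -> conf_module t <= conf_module t'.

End States.

(* Main.v *)
Require Import Defs.
From HB Require Import structures.
From mathcomp Require Import all_boot all_order all_algebra all_field.
From mathcomp Require Import all_classical all_reals all_analysis.
From mathcomp.real_closed Require Import complex.
From mathcomp Require Import ring lra.

Set Implicit Arguments.
Unset Strict Implicit.
Unset Printing Implicit Defensive.

Import Order.TTheory GRing.Theory Num.Theory.
Import numFieldNormedType.Exports.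

Local Open Scope classical_set_scope.
Local Open Scope ring_scope.

(** Identify the plane spanned by a and b with the complex line, oriented so
    that b / a has positive imaginary part; this quotient is the point z.  Both
    cosh d(z, i) = (|z|^2 + 1) / (2 Im z) and T / (2 A) are then the same
    expression in |a|, |b| and the angle between them, since
    A^2 = |a|^2 |b|^2 - (a . b)^2 ([conf_moduleE]).  As cosh increases on the
    nonnegative reals, minimizing m means minimizing d(z, i).

    Multiplying a + ib by w = p + iq replaces the pair (a, b) by
    (p a - q b, q a + p b), hence z = b / a by (q + p z) / (p - q z).  This
    transformation ([moebius]) only depends on the argument of w, preserves the
    hyperbolic distance, fixes i and has derivative w / conj w there
    ([moebius_elliptic], [pair_z_moebius]).  A unit scales xi by a nonzero real
    number, so that the orthogonal projection is unchanged and a_perp + i b_perp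
    is multiplied by the complex embedding of the unit ([cvec_perp_scale]).

    Two arithmetic facts remain.  That z lies in the upper half-plane says that
    a_perp and b_perp are independent, which is the linear independence of the
    embeddings of K ([embeddings_independent]).  That a fixed z forces the
    embedded unit to be real needs z <> i, because i is fixed by every
    similarity ([z_perp_neq_i]).  If z = i, the Gram determinant of the vectors
    (sr u_k) and (sc u_k) for the complex bilinear form vanishes.  The Galois
    group of a cubic field is transitive on its embeddings, so it contains a
    3-cycle, and this relation also holds for the pair (sc, conj sc)
    ([gram_transport]).  There it is the equality case of the Cauchy-Schwarz
    inequality for the real and imaginary parts of (sc u_k), which are
    independent. *)

Section Pairs.
Variable R : realType.
Implicit Types (x y : R) (z w : R[i]) (a b u v : 'rV[R]_3).

(** * Pairs of vectors in three-space *)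

Lemma dotE u v : dot u v = u 0 0 * v 0 0 + u 0 1 * v 0 1 + u 0 2 * v 0 2.
Proof.
rewrite /dot !big_ord_recl big_ord0 addr0 addrA.
by congr (_ + u 0 _ * v 0 _ + u 0 _ * v 0 _); apply/val_inj.
Qed.

Lemma dotC u v : dot u v = dot v u.
Proof. by rewrite !dotE; ring. Qed.

Lemma dotZl x u v : dot (x *: u) v = x * dot u v.
Proof. by rewrite !dotE !mxE; ring. Qed.

Lemma dot_ge0 u : 0 <= dot u u.
Proof. by rewrite dotE !addr_ge0 // -expr2 sqr_ge0. Qed.

Lemma row3P u v : u 0 0 = v 0 0 -> u 0 1 = v 0 1 -> u 0 2 = v 0 2 -> u = v.
Proof.
move=> h0 h1 h2; apply/rowP => -[[|[|[|//]]] hk].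
- by have -> : Ordinal hk = 0 by apply/val_inj.
- by have -> : Ordinal hk = 1 by apply/val_inj.
- by have -> : Ordinal hk = 2 by apply/val_inj.
Qed.

Lemma dot_eq0 u : dot u u = 0 -> u = 0.
Proof.
rewrite dotE -!expr2 => /eqP.
rewrite !paddr_eq0 ?addr_ge0 ?sqr_ge0 // !sqrf_eq0.
move=> /andP[/andP[/eqP h0 /eqP h1] /eqP h2].
by apply: row3P; rewrite mxE.
Qed.

Lemma enorm_sqr u : enorm u ^+ 2 = dot u u.
Proof. by rewrite sqr_sqrtr ?dot_ge0. Qed.

(** The Lagrange identity. *)
Lemma pair_A_sqr a b :
  pair_A a b ^+ 2 = dot a a * dot b b - dot a b ^+ 2.
Proof.
rewrite enorm_sqr !dotE !mxE.
have -> : (0 + 1 : 'I_3) = 1 by apply/val_inj.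
have -> : (0 + 2 : 'I_3) = 2 by apply/val_inj.
have -> : (1 + 1 : 'I_3) = 2 by apply/val_inj.
have -> : (1 + 2 : 'I_3) = 0 by apply/val_inj.
have -> : (2 + 1 : 'I_3) = 0 by apply/val_inj.
have -> : (2 + 2 : 'I_3) = 1 by apply/val_inj.
ring.
Qed.

Lemma pair_A_ge0 a b : 0 <= pair_A a b.
Proof. exact: sqrtr_ge0. Qed.

(** The strict Cauchy-Schwarz inequality: a vanishing Gram determinant makes
    [dot a a *: b - dot a b *: a] isotropic, hence zero. *)
Lemma dot_gram_gt0 a b :
  (forall x y, x *: a + y *: b = 0 -> x = 0 /\ y = 0) ->
  0 < dot a a * dot b b - dot a b ^+ 2.
Proof.
move=> hfree.
have haa : dot a a != 0.
  apply/eqP => /dot_eq0 a0; have := hfree 1 0.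
  by rewrite a0 scaler0 scale0r addr0 => /(_ erefl)[/eqP]; rewrite oner_eq0.
rewrite -pair_A_sqr lt_def sqr_ge0 andbT pair_A_sqr; apply/eqP => hG.
have h : dot a a *: b + (- dot a b) *: a = 0.
  apply: dot_eq0; transitivity (dot a a * (dot a a * dot b b - dot a b ^+ 2)).
    by rewrite !dotE !mxE; ring.
  by rewrite hG mulr0.
by move: h; rewrite addrC => /hfree[_ /eqP]; rewrite (negPf haa).
Qed.

Lemma pair_A_gt0 a b :
  (forall x y, x *: a + y *: b = 0 -> x = 0 /\ y = 0) -> 0 < pair_A a b.
Proof.
move=> /dot_gram_gt0; rewrite -pair_A_sqr => h.
by rewrite lt_def pair_A_ge0 andbT; apply: contraTneq h => ->; rewrite expr0n ltxx.
Qed.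

Lemma pair_zE a b :
  pair_z a b = ((dot a b / dot a a) +i* (pair_A a b / dot a a))%C.
Proof.
rewrite /pair_z enorm_sqr; have [->|h] := eqVneq (dot a a) 0.
  by rewrite (_ : (0%:C)%C = 0 :> R[i]) // !invr0 !mulr0.
by apply/eqP; rewrite eq_complex /=; apply/andP; split; apply/eqP; field.
Qed.

Lemma pair_A_gt0_norm a b : 0 < pair_A a b -> 0 < dot a a.
Proof.
move=> /(exprn_gt0 2) hA; rewrite lt_def dot_ge0 andbT.
apply: contraTneq hA => h.
by rewrite pair_A_sqr h mul0r sub0r oppr_gt0 -leNgt sqr_ge0.
Qed.

Lemma pair_z_upper a b : upper_half_plane (pair_z a b) <-> 0 < pair_A a b.
Proof.
rewrite pair_zE /upper_half_plane /=; split => h; last first.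
  by rewrite divr_gt0 // (pair_A_gt0_norm h).
rewrite lt_def pair_A_ge0 andbT; apply: contraTneq h => ->.
by rewrite mul0r ltxx.
Qed.

(** * The hyperbolic distance *)

(** The square of sinh (d(z, w) / 2).  It is a rational function of the
    coordinates, so that invariance of the distance becomes a field identity. *)
Definition chord_ratio z w : R :=
 ((complex.Re z - complex.Re w) ^+ 2 + (complex.Im z - complex.Im w) ^+ 2) /
  (4 * (complex.Im z * complex.Im w)).

Lemma hdistE z w : upper_half_plane z -> upper_half_plane w ->
  hdist z w = 2 * arsinh (Num.sqrt (chord_ratio z w)).
Proof.
rewrite /upper_half_plane /= => hz hw.
rewrite /hdist /chord_ratio; congr (2 * arsinh _).
rewrite [RHS]sqrtrM ?addr_ge0 ?sqr_ge0 // sqrtrV ?mulr_ge0 ?ltW //.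
rewrite (@sqrtrM _ 4) // (_ : 4 = 2 ^+ 2); last by ring.
rewrite sqrtr_sqr normr_nat normc_def.
by case: z w {hz hw} => [x y] [x' y'].
Qed.

(** With t = sqrt (x^2 + 1), the inverse of exp (arsinh x) = x + t is t - x. *)
Lemma cosh_double_arsinh x : cosh (2 * arsinh x) = 1 + 2 * x ^+ 2.
Proof.
rewrite /cosh /arsinh; set t := Num.sqrt _.
have ht : t ^+ 2 = x ^+ 2 + 1 by rewrite sqr_sqrtr // addr_ge0 ?sqr_ge0.
have ht0 : 0 < t by rewrite sqrtr_gt0 ltr_wpDl ?sqr_ge0.
have hE : 0 < x + t.
  (* |x| = sqrt (x ^ 2) < t *)
  rewrite -ltrBlDl sub0r (le_lt_trans (ler_norm _)) // normrN -sqrtr_sqr.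
  by rewrite ltr_sqrt ?ltr_pwDr ?ltr_wpDl ?sqr_ge0.
rewrite expRN mulr_natl mulr2n expRD lnK ?posrE //.
have -> : ((x + t) * (x + t))^-1 = (t - x) * (t - x).
  apply: (mulfI (x := (x + t) * (x + t))); rewrite ?mulf_neq0 ?gt_eqF //.
  rewrite divff ?mulf_neq0 ?gt_eqF //.
  transitivity ((t ^+ 2 - x ^+ 2) ^+ 2); last by ring.
  by rewrite ht; ring.
transitivity (t ^+ 2 + x ^+ 2); first by field.
by rewrite ht; ring.
Qed.

Lemma arsinh_le x y : 0 <= x -> x <= y -> arsinh x <= arsinh y.
Proof.
move=> x0 xy; rewrite /arsinh; have y0 := le_trans x0 xy.
rewrite ler_ln ?posrE ?ltr_wpDl // ?sqrtr_gt0 ?ltr_wpDl ?sqr_ge0 //.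
rewrite lerD // ler_sqrt ?addr_ge0 ?sqr_ge0 //.
by rewrite lerD2r ler_sqr // nnegrE.
Qed.

Lemma chord_ratio_ge0 z w : upper_half_plane z -> upper_half_plane w ->
  0 <= chord_ratio z w.
Proof.
rewrite /upper_half_plane /= => /ltW hz /ltW hw.
by rewrite divr_ge0 ?addr_ge0 ?sqr_ge0 // !mulr_ge0.
Qed.

Lemma cosh_hdist z w : upper_half_plane z -> upper_half_plane w ->
  cosh (hdist z w) = 1 + 2 * chord_ratio z w.
Proof.
move=> hz hw; rewrite hdistE // cosh_double_arsinh sqr_sqrtr //.
exact: chord_ratio_ge0.
Qed.

Lemma upper_half_plane_i : upper_half_plane ('i%C : R[i]).
Proof. by rewrite /upper_half_plane /=. Qed.

(** Through sinh (d / 2) rather than through monotonicity of cosh: both sides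
    are increasing functions of the chord ratio. *)
Lemma hdist_le_cosh z z' w : upper_half_plane z -> upper_half_plane z' ->
  upper_half_plane w ->
  cosh (hdist z w) <= cosh (hdist z' w) -> hdist z w <= hdist z' w.
Proof.
move=> hz hz' hw; rewrite !cosh_hdist // lerD2l ler_pM2l // => h.
rewrite !hdistE // ler_pM2l // arsinh_le ?sqrtr_ge0 // ler_sqrt //.
exact: chord_ratio_ge0.
Qed.

(** With z = x + iy the distance formula gives (x^2 + y^2 + 1) / (2 y), and
    x^2 + y^2 = |b|^2 / |a|^2 by the Lagrange identity. *)
Lemma pair_conf a b : 0 < pair_A a b ->
  pair_T a b / (2 * pair_A a b) = cosh (hdist (pair_z a b) 'i%C).
Proof.
move=> hA; have hn := pair_A_gt0_norm hA.
rewrite cosh_hdist; [|exact/pair_z_upper|exact: upper_half_plane_i].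
rewrite pair_zE /chord_ratio /= /pair_T !enorm_sqr.
have hG : dot b b = (pair_A a b ^+ 2 + dot a b ^+ 2) / dot a a.
  by rewrite pair_A_sqr; field; rewrite gt_eqF.
by rewrite hG; field; rewrite !gt_eqF.
Qed.

(** * Complex similarities act on the half-plane *)

(** The action on b / a of the multiplication of a + ib by w: the homography of
    the real matrix with rows (Re w, Im w) and (- Im w, Re w), a rotation matrix
    up to scaling. *)
Definition moebius w z : R[i] :=
  ((complex.Im w)%:C + (complex.Re w)%:C * z)%C /
  ((complex.Re w)%:C - (complex.Im w)%:C * z)%C.

(** The squared modulus of the denominator of [moebius w z]. *)
Definition moebius_den w z : R :=
  (complex.Re w - complex.Im w * complex.Re z) ^+ 2 +
  (complex.Im w * complex.Im z) ^+ 2.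

Lemma moebius_den_gt0 w z : w != 0 -> upper_half_plane z -> 0 < moebius_den w z.
Proof.
rewrite /upper_half_plane /moebius_den eq_complex /=.
case: w z => [p q] [x y] /= hw hy.
have [q0|q0] := eqVneq q 0.
  move: hw; rewrite q0 eqxx andbT => hp; rewrite !mul0r subr0 expr0n addr0.
  by rewrite exprn_even_gt0.
by rewrite ltr_wpDl ?sqr_ge0 // exprn_even_gt0 //= mulf_neq0 // gt_eqF.
Qed.

Lemma moebiusE w z : w != 0 -> upper_half_plane z ->
  moebius w z =
  (((complex.Im w + complex.Re w * complex.Re z) *
     (complex.Re w - complex.Im w * complex.Re z) -
    complex.Re w * complex.Im w * complex.Im z ^+ 2) / moebius_den w z
   +i* ((complex.Re w ^+ 2 + complex.Im w ^+ 2) * complex.Im z /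
         moebius_den w z))%C.
Proof.
move=> hw hz; have := moebius_den_gt0 hw hz; rewrite /moebius_den.
case: w z hw hz => [p q] [x y] /= hw hz hD.
apply/eqP; rewrite eq_complex /=; apply/andP; split; apply/eqP; field.
  by rewrite !gt_eqF //; move: hD; rewrite !(mul0r, mulr0, subr0, addr0, add0r).
by rewrite !gt_eqF //; move: hD; rewrite !(mul0r, mulr0, subr0, addr0, add0r).
Qed.

Lemma moebius_den_neq0 w z : w != 0 -> upper_half_plane z ->
  ((complex.Re w)%:C - (complex.Im w)%:C * z)%C != 0 :> R[i].
Proof.
move=> hw hz; have := moebius_den_gt0 hw hz; rewrite /moebius_den.
apply: contraTneq; case: w z {hw hz} => [p q] [x y] /= [].
rewrite mul0r subr0 mul0r addr0 => -> /eqP; rewrite sub0r oppr_eq0 => /eqP ->.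
by rewrite expr0n addr0 ltxx.
Qed.

Lemma sqr_norm_gt0 w : w != 0 -> 0 < complex.Re w ^+ 2 + complex.Im w ^+ 2.
Proof.
case: w => p q; rewrite eq_complex negb_and /= => /orP[] h.
  by rewrite ltr_pwDl ?sqr_ge0 // exprn_even_gt0.
by rewrite ltr_wpDl ?sqr_ge0 // exprn_even_gt0.
Qed.

Lemma moebius_upper w z : w != 0 -> upper_half_plane z ->
  upper_half_plane (moebius w z).
Proof.
move=> hw hz; rewrite /upper_half_plane moebiusE //=.
by rewrite divr_gt0 ?mulr_gt0 ?moebius_den_gt0 ?sqr_norm_gt0.
Qed.

(** The homography multiplies imaginary parts by |w|^2 / |D(z)|^2 and differences
    by |w|^2 / (D(z) D(z')), where D is the denominator; these factors cancel
    in the quotient. *)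
Lemma chord_ratio_moebius w z z' : w != 0 ->
  upper_half_plane z -> upper_half_plane z' ->
  chord_ratio (moebius w z) (moebius w z') = chord_ratio z z'.
Proof.
move=> hw hz hz'; rewrite /chord_ratio !moebiusE //.
have := moebius_den_gt0 hw hz; have := moebius_den_gt0 hw hz'.
have := sqr_norm_gt0 hw.
move: hz hz'; rewrite /upper_half_plane /moebius_den /=.
case: w z z' {hw} => [p q] [x y] [x' y'] /= hy hy' hN hD' hD.
by field; rewrite !gt_eqF.
Qed.

Lemma hdist_moebius w z z' : w != 0 ->
  upper_half_plane z -> upper_half_plane z' ->
  hdist (moebius w z) (moebius w z') = hdist z z'.
Proof.
by move=> hw hz hz'; rewrite !hdistE ?chord_ratio_moebius //; apply: moebius_upper.
Qed.

Lemma moebius_i w : w != 0 -> moebius w 'i%C = 'i%C.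
Proof.
move=> hw; rewrite moebiusE //; last exact: upper_half_plane_i.
have := sqr_norm_gt0 hw.
rewrite /moebius_den /= !mulr0 !mulr1 subr0 addr0 expr1n mulr1.
by move=> hN; congr (_ +i* _)%C; field; rewrite gt_eqF.
Qed.

Lemma sqr_norm_complex w : ((complex.Re w)%:C ^+ 2 + (complex.Im w)%:C ^+ 2)%C =
  ((complex.Re w ^+ 2 + complex.Im w ^+ 2)%:C)%C :> R[i].
Proof. by rewrite rmorphD !rmorphXn. Qed.

(** The conjugate of w has the adjugate matrix, so that the composite is the
    homography of a scalar matrix. *)
Lemma moebius_conjK w z : w != 0 -> upper_half_plane z ->
  moebius (w^*)%C (moebius w z) = z.
Proof.
move=> hw hz; have hD := moebius_den_neq0 hw hz.
have hN : ((complex.Re w)%:C ^+ 2 + (complex.Im w)%:C ^+ 2)%C != 0 :> R[i].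
  by rewrite sqr_norm_complex eq_complex /= eqxx andbT gt_eqF ?sqr_norm_gt0.
rewrite /moebius; set p := ((complex.Re w)%:C)%C in hD hN *.
set q := ((complex.Im w)%:C)%C in hD hN *.
have -> : ((complex.Re w^*)%:C)%C = p by rewrite /p; case: (w).
have -> : ((complex.Im w^*)%:C)%C = - q by rewrite /q -rmorphN; case: (w).
move: p q hD hN => p q hD hN; field; rewrite hD /=.
by apply: contraNneq hN => h; apply/eqP; rewrite -[RHS]h; ring.
Qed.

Lemma moebius_real x w z : x != 0 -> moebius (x%:C%C * w) z = moebius w z.
Proof.
move=> hx; have hxC : (x%:C)%C != 0 :> R[i] by rewrite eq_complex /= eqxx andbT.
have -> : (moebius (x%:C%C * w) z =
  (x%:C * ((complex.Im w)%:C + (complex.Re w)%:C * z)) /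
  (x%:C * ((complex.Re w)%:C - (complex.Im w)%:C * z)))%C.
  rewrite /moebius; case: w => p q /=; rewrite !mul0r subr0 addr0 !rmorphM.
  by congr (_ / _); ring.
by rewrite invfM mulrACA divff // mul1r.
Qed.

(** The fixed point equation is Im w (z^2 + 1) = 0, and - i is not in the upper
    half-plane. *)
Lemma moebius_fixed w z : w != 0 -> upper_half_plane z -> z != 'i%C ->
  (moebius w z = z <-> w \is Num.real).
Proof.
move=> hw hz hzi; have hD := moebius_den_neq0 hw hz.
have -> : (w \is Num.real) = (complex.Im w == 0).
  by case: (w) => p q; rewrite complex_real.
split=> [h|/eqP hq]; last first.
  have h0 : (complex.Im w)%:C%C = 0 :> R[i] by rewrite hq.
  move: hD; rewrite /moebius h0 mul0r subr0 add0r => hD.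
  by rewrite mulrAC divff ?mul1r.
have {}h : (complex.Im w)%:C%C * ((z - 'i%C) * (z + 'i%C)) = 0.
  move: h; rewrite /moebius => /(canRL (divfK hD)) h.
  have hi : 'i%C * 'i%C = -1 :> R[i] by rewrite -expr2 sqr_i.
  transitivity ((complex.Im w)%:C%C * (z ^+ 2 - 'i%C * 'i%C)); first by ring.
  rewrite hi; transitivity ((complex.Im w)%:C + (complex.Re w)%:C * z -
     z * ((complex.Re w)%:C - (complex.Im w)%:C * z))%C; first by ring.
  by rewrite h subrr.
move/eqP: h; rewrite !mulf_eq0 subr_eq0 (negPf hzi) /= => /orP[/eqP[->]//|].
move: hz; rewrite addr_eq0 /upper_half_plane /= => hz /eqP hE.
by move: hz; rewrite hE /= ltr0N1.
Qed.

(** The difference quotient is exactly w / (conj w - Im w h), as long as this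
    denominator does not vanish. *)
Lemma moebius_cvg_at_i w : w != 0 ->
  ((moebius w ('i%C + h) - moebius w 'i%C) / h : R[i]^o)
        @[h --> (0 : R[i]^o)^'] --> (w / (w^*)%C : R[i]^o).
Proof.
move=> hw; rewrite moebius_i //.
have hcw : (w^*)%C != 0 by rewrite conjc_eq0.
pose f (h : R[i]^o) : R[i]^o := (w^*)%C - (complex.Im w)%:C%C * h.
have hf : f h @[h --> (0 : R[i]^o)^'] --> ((w^*)%C : R[i]^o).
  rewrite -[X in _ --> X]subr0 -[in X in _ --> X](mulr0 (complex.Im w)%:C%C).
  apply: cvgB; first exact: cvg_cst.
  apply: cvgM; first exact: cvg_cst.
  exact: nbhs_dnbhs.
have hf0 : \forall h \near (0 : R[i]^o)^', f h != 0.
  exact: (cvgr_neq0 _ hf hcw).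
have hn0 : \forall h \near (0 : R[i]^o)^', h != 0.
  exact: (@nbhs_dnbhs_neq (R[i]^o) 0).
apply: (@cvg_trans _ ((w / f h : R[i]^o) @[h --> (0 : R[i]^o)^'])); last first.
  by apply: cvgM; [exact: cvg_cst|exact: cvgV].
apply: near_eq_cvg; near=> h.
have hh : h != 0 by near: h.
have hfh : f h != 0 by near: h.
(* With w = p + iq and D = conj w - q h the denominator of the map at i + h,
   (q + p (i + h)) - i D = w h. *)
have hi : 'i%C * 'i%C = -1 :> R[i] by rewrite -expr2 sqr_i.
have hcw' : (w^*)%C = (complex.Re w)%:C%C - 'i%C * (complex.Im w)%:C%C.
  by case: (w) => p q; simpc.
rewrite /moebius.
have -> : (complex.Re w)%:C%C - (complex.Im w)%:C%C * ('i%C + h) = f h.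
  by rewrite /f hcw'; ring.
have -> : (complex.Im w)%:C%C + (complex.Re w)%:C%C * ('i%C + h) =
          'i%C * f h + w * h.
  have -> : w * h = ((complex.Re w)%:C%C + 'i%C * (complex.Im w)%:C%C) * h.
    by rewrite -complexE.
  rewrite /f hcw'.
  transitivity ((complex.Re w)%:C%C * ('i%C + h) -
                ('i%C * 'i%C) * (complex.Im w)%:C%C).
    by rewrite hi; ring.
  by ring.
by rewrite [X in X - _]mulrDl mulfK // addrC addKr mulrAC mulfK.
Unshelve. all: by end_near.
Qed.

Lemma expi_neq0 (theta : R) : expi theta != 0.
Proof.
rewrite eq_complex /=; apply/negP => /andP[/eqP hc /eqP hs].
by have /eqP := cos2Dsin2 theta; rewrite hc hs expr0n addr0 eq_sym oner_eq0.
Qed.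

(** At |w| = 1 the derivative w / conj w is w^2, whence the doubled angle. *)
Lemma moebius_elliptic (theta : R) :
  elliptic_at_i (2 * theta) (moebius (expi theta)).
Proof.
have he : expi theta != 0 by exact: expi_neq0.
have hce : (expi theta)^*%C != 0 by rewrite conjc_eq0.
split.
- split.
  + by move=> z /(moebius_upper he).
  + move=> z z' /set_mem hz /set_mem hz' hE.
    by rewrite -(moebius_conjK he hz) hE moebius_conjK.
  + move=> z hz; exists (moebius (expi theta)^*%C z); first exact: moebius_upper.
    by have := moebius_conjK hce hz; rewrite conjcK.
- by move=> z w; exact: hdist_moebius.
- exact: moebius_i.
have -> : expi (2 * theta) = expi theta / (expi theta)^*%C.
  apply: (canRL (mulfK hce)); rewrite mulr_natl mulr2n /expi cosD sinD; simpc.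
  have h := cos2Dsin2 theta; congr (_ +i* _)%C.
    transitivity (cos theta * (cos theta ^+ 2 + sin theta ^+ 2)); first by ring.
    by rewrite h mulr1.
  transitivity (sin theta * (cos theta ^+ 2 + sin theta ^+ 2)); first by ring.
  by rewrite h mulr1.
exact: moebius_cvg_at_i.
Qed.

Lemma cvec_scaleP w a0 b0 a b : cvec a b = w *: cvec a0 b0 <->
  a = complex.Re w *: a0 - complex.Im w *: b0 /\
  b = complex.Im w *: a0 + complex.Re w *: b0.
Proof.
split=> [h|[-> ->]]; last first.
  by apply/rowP => k; rewrite !mxE; case: w => p q /=; rewrite [q * _ + _]addrC.
by split; apply/rowP => k; move/rowP: h => /(_ k); rewrite !mxE;
  case: w => p q /= [h1 h2]; rewrite ?h1 ?h2 // addrC.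
Qed.

(** The area A is a square root, hence nonnegative, and gets multiplied by |w|^2
    exactly; therefore no orientation of the plane of the pair is chosen. *)
Lemma pair_z_moebius w a0 b0 a b : w != 0 -> 0 < pair_A a0 b0 ->
  cvec a b = w *: cvec a0 b0 -> pair_z a b = moebius w (pair_z a0 b0).
Proof.
move=> hw hA /cvec_scaleP[ha hb].
have hz : upper_half_plane (pair_z a0 b0) by apply/pair_z_upper.
have hD := moebius_den_gt0 hw hz; have hN := sqr_norm_gt0 hw.
have hn := pair_A_gt0_norm hA.
have hA' : pair_A a b = (complex.Re w ^+ 2 + complex.Im w ^+ 2) * pair_A a0 b0.
  apply/eqP; rewrite -(@eqrXn2 _ 2) ?mulr_ge0 ?pair_A_ge0 ?(ltW hN) //.
  rewrite exprMn !pair_A_sqr ha hb; apply/eqP.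
  by rewrite !dotE !mxE; ring.
set p := complex.Re w in ha hb hD hN hA' *.
set q := complex.Im w in ha hb hD hN hA' *.
have hdab : dot a b = p * q * dot a0 a0 + (p ^+ 2 - q ^+ 2) * dot a0 b0
                      - p * q * dot b0 b0.
  by rewrite ha hb !dotE !mxE; ring.
have hdaa : dot a a = p ^+ 2 * dot a0 a0 - 2 * p * q * dot a0 b0
                      + q ^+ 2 * dot b0 b0.
  by rewrite ha !dotE !mxE; ring.
have hG : dot b0 b0 = (pair_A a0 b0 ^+ 2 + dot a0 b0 ^+ 2) / dot a0 a0.
  by rewrite pair_A_sqr; field; rewrite gt_eqF.
have hden : dot a a = moebius_den w (pair_z a0 b0) * dot a0 a0.
  rewrite hdaa hG /moebius_den pair_zE -/p -/q /=; field; rewrite gt_eqF //.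
rewrite moebiusE // [pair_z a b]pair_zE hden hA' hdab hG.
rewrite -/p -/q; congr (_ +i* _)%C; rewrite [pair_z a0 b0]pair_zE /=;
  move: hD; rewrite pair_zE => hD; field; rewrite ?gt_eqF //.
Qed.

End Pairs.

(** * States of a complex cubic field *)

Section Cubic.
Variables (R : realType) (K : fieldExtType rat).
Variables (sr : {rmorphism K -> R}) (sc : {rmorphism K -> R[i]}).
Implicit Types (s t : 3.-tuple K).

(** Independence of the characters sr, sc and conj sc, in real form.  Writing
    the relation at x0 u and subtracting sr x0 times the relation at u
    eliminates sr; what is left is evaluated at u = 1 and u = x0. *)
Lemma embeddings_independent (x0 : K) (x : R) (w : R[i]) :
  sc x0 \isn't Num.real ->
  (forall u, x * sr u + complex.Re (w * sc u) = 0) -> x = 0 /\ w = 0.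
Proof.
move=> hx0 h.
have hd : sc x0 - (sr x0)%:C%C != 0.
  apply: contraNneq hx0 => /eqP; rewrite subr_eq0 => /eqP ->.
  by rewrite complex_real.
pose w' := w * (sc x0 - (sr x0)%:C%C).
have hw' u : complex.Re (w' * sc u) = 0.
  have h1 := h (x0 * u); have h2 := h u.
  transitivity (x * sr (x0 * u) + complex.Re (w * sc (x0 * u)) -
     sr x0 * (x * sr u + complex.Re (w * sc u))); last by rewrite h1 h2; ring.
  rewrite /w' !rmorphM /=; case: (sc x0) (sc u) (w) => [a b] [c d] [p q] /=.
  by ring.
have w'0 : w' = 0.
  have := hw' 1; have := hw' x0; rewrite rmorph1 mulr1.
  case: (w') (sc x0) hx0 => [p q] [a b]; rewrite complex_real /= => hb h1 h2.
  rewrite h2 in h1 *; congr (_ +i* _)%C; apply: (mulIf hb); rewrite mul0r.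
  by rewrite -[RHS]oppr0 -[in RHS]h1; ring.
move/eqP: w'0; rewrite mulf_eq0 (negPf hd) orbF => /eqP w0; split => //.
by have := h 1; rewrite w0 mul0r /= rmorph1 mulr1 addr0.
Qed.

Lemma embedding_scale (F : fieldType) (f : {rmorphism K -> F}) (c : rat) u :
  f (c *: u) = ratr c * f u.
Proof. by rewrite -mulr_algl rmorphM alg_num_field fmorph_rat. Qed.

(** A relation between embeddings on a family spanning K over the rationals
    extends to K, since embeddings are linear over the rationals. *)
Lemma embeddings_independent_on_span (x0 : K) s (x : R) (w : R[i]) :
  sc x0 \isn't Num.real -> << s >>%VS = fullv ->
  (forall k, x * sr (tnth s k) + complex.Re (w * sc (tnth s k)) = 0) ->
  x = 0 /\ w = 0.
Proof.
move=> hx0 hs h; apply: (embeddings_independent hx0) => u.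
have : u \in << s >>%VS by rewrite hs memvf.
move/coord_span => ->; rewrite !rmorph_sum /= mulr_sumr mulr_sumr raddf_sum /=.
rewrite -big_split big1 //= => k _.
rewrite -tnth_nth !embedding_scale -(fmorph_rat (real_complex R)).
transitivity (ratr (coord s k u) *
    (x * sr (tnth s k) + complex.Re (w * sc (tnth s k)))).
  by case: (w) (sc _) => [p q] [a b] /=; ring.
by rewrite h mulr0.
Qed.

Definition rvec s : 'rV[R]_3 := \row_k complex.Re (sc (tnth s k)).
Definition ivec s : 'rV[R]_3 := \row_k complex.Im (sc (tnth s k)).

(** The real combination x Re + y Im is the real part of the multiplication by
    x - iy. *)
Lemma coordinate_vectors_free (x0 : K) s (c x y : R) :
  sc x0 \isn't Num.real -> << s >>%VS = fullv ->
  c *: xi sr s + x *: rvec s + y *: ivec s = 0 -> [/\ c = 0, x = 0 & y = 0].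
Proof.
move=> hx0 hs h.
have [k|-> [-> /eqP]] :=
  @embeddings_independent_on_span x0 s c (x -i* y)%C hx0 hs; last first.
  by rewrite oppr_eq0 => /eqP.
have := congr1 (fun M : 'rV__ => M 0 k) h; rewrite !mxE => <-.
by case: (sc _) => a b /=; ring.
Qed.

Lemma proj_perpE s v :
  proj_perp sr s v = v - (dot v (xi sr s) / dot (xi sr s) (xi sr s)) *: xi sr s.
Proof.
rewrite /proj_perp /xihat dotC dotZl scalerA mulrAC -expr2 exprVn enorm_sqr.
by rewrite [_^-1 * _]mulrC dotC.
Qed.

Lemma dot_proj_perp s u v : dot (xi sr s) (xi sr s) != 0 ->
  dot (proj_perp sr s u) (proj_perp sr s v) =
  dot u v - dot u (xi sr s) * dot v (xi sr s) / dot (xi sr s) (xi sr s).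
Proof.
rewrite !proj_perpE; set x := xi sr s => hx.
transitivity (dot u v - dot v x / dot x x * dot u x - dot u x / dot x x * dot v x
              + dot u x / dot x x * (dot v x / dot x x) * dot x x).
  move: (dot u x / _) (dot v x / _) => c d.
  by rewrite !dotE !mxE; ring.
by field.
Qed.

Lemma perp_free (x0 : K) s (x y : R) :
  sc x0 \isn't Num.real -> << s >>%VS = fullv ->
  x *: a_perp sr sc s + y *: b_perp sr sc s = 0 -> x = 0 /\ y = 0.
Proof.
move=> hx0 hs; rewrite /a_perp /b_perp !proj_perpE -/(rvec s) -/(ivec s).
set c := _ / _; set d := _ / _ => h.
have [] := @coordinate_vectors_free x0 s (- (x * c + y * d)) x y hx0 hs => //.
by rewrite -[RHS]h; apply/rowP => k; rewrite !mxE; ring.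
Qed.

Lemma pair_A_state_gt0 (x0 : K) s :
  sc x0 \isn't Num.real -> << s >>%VS = fullv ->
  0 < pair_A (a_perp sr sc s) (b_perp sr sc s).
Proof. by move=> hx0 hs; apply: pair_A_gt0 => x y; exact: perp_free hx0 hs. Qed.

Lemma conf_moduleE s : 0 < pair_A (a_perp sr sc s) (b_perp sr sc s) ->
  conf_module sr sc s = cosh (hdist (z_perp sr sc s) 'i%C).
Proof. exact: pair_conf. Qed.

Lemma tnth3E (T : Type) (a b c : T) :
  (tnth [tuple a; b; c] 0 = a) * (tnth [tuple a; b; c] 1 = b) *
  (tnth [tuple a; b; c] 2 = c).
Proof. by rewrite !(tnth_nth a). Qed.

(** The moves are unimodular: the old entries are integral combinations of the
    new ones. *)
Lemma candidate_span s t : << s >>%VS = fullv -> candidate sr s t ->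
  << t >>%VS = fullv.
Proof.
move=> hs [hst _]; apply/eqP; rewrite eqEsubv subvf /= -hs; apply/span_subvP.
move=> u /tnthP[k ->] {u}.
have ht j : tnth t j \in << t >>%VS by exact/memv_span/mem_tnth.
have h0 := ht 0; have h1 := ht 1; have h2 := ht 2.
have [e0 e1 e2] : [/\ tnth s 0 \in << t >>%VS, tnth s 1 \in << t >>%VS &
    tnth s 2 \in << t >>%VS].
  case: hst => [[A [B [g [_ E]]]]|E].
  - have E0 : tnth s 0 = tnth t 0 + tnth t 2 *+ A + tnth t 1 *+ g.
      by rewrite E /move_V /move_W !tnth3E !subrK.
    have E1 : tnth s 1 = tnth t 1 + tnth t 2 *+ B.
      by rewrite E /move_V /move_W !tnth3E subrK.
    have E2 : tnth s 2 = tnth t 2 by rewrite E /move_V /move_W !tnth3E.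
    by rewrite E0 E1 E2; split; rewrite ?rpredD ?rpredMn.
  - have E0 : tnth s 0 = tnth t 0 + tnth t 1.
      by rewrite E /move_V /move_W !tnth3E subrK.
    have E1 : tnth s 1 = tnth t 1 by rewrite E /move_V /move_W !tnth3E.
    have E2 : tnth s 2 = tnth t 2 + tnth t 0.
      by rewrite E /move_V /move_W !tnth3E subrK.
    by rewrite E0 E1 E2; split; rewrite ?rpredD.
case: k => [[|[|[|//]]] hk].
- by rewrite (_ : Ordinal hk = 0) //; apply/val_inj.
- by rewrite (_ : Ordinal hk = 1) //; apply/val_inj.
- by rewrite (_ : Ordinal hk = 2) //; apply/val_inj.
Qed.

(** * Transport of relations to the conjugate embeddings *)

Section Transport.
Variable x0 : K.
Hypothesis hx0 : sc x0 \isn't Num.real.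
Hypothesis hdim : \dim {:K} = 3%N.

Let embC : {rmorphism K -> R[i]} := real_complex R \o sr.

(** The degree 3 being prime, every irrational element generates K. *)
Lemma generator_full : <<1; x0>>%VS = fullv.
Proof.
have hd : (\dim <<1; x0>> %| 3)%N.
  by rewrite -hdim; apply: field_dimS; exact: subvf.
have h1 : \dim <<1; x0>> != 1%N.
  rewrite dim_Fadjoin dimv1 muln1 adjoin_deg_eq1; apply: contra hx0.
  move=> /vlineP[c ->].
  rewrite embedding_scale rmorph1 mulr1 -(fmorph_rat (real_complex R)).
  by rewrite complex_real.
apply/eqP; rewrite eqEdim subvf /= hdim.
by move: hd h1; rewrite dvdn_divisors // !inE => /orP[/eqP->|/eqP->].
Qed.

Lemma generator_poly u : exists p : {poly rat}, u = (map_poly (in_alg K) p).[x0].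
Proof.
have : u \in <<1; x0>>%VS by rewrite generator_full memvf.
by move/Fadjoin1_polyP.
Qed.

Lemma map_poly_embedding (F : fieldType) (f : {rmorphism K -> F})
    (p : {poly rat}) :
  map_poly f (map_poly (in_alg K) p) = map_poly ratr p.
Proof.
rewrite -map_poly_comp; apply: eq_map_poly => c /=.
by rewrite alg_num_field fmorph_rat.
Qed.

Lemma horner_ratr_conj (p : {poly rat}) (z : R[i]) :
  (map_poly ratr p).[(z^*)%C] = ((map_poly ratr p).[z]^*)%C.
Proof.
rewrite -horner_map; congr (_.[_]); rewrite -map_poly_comp.
by apply: eq_map_poly => c /=; rewrite fmorph_rat.
Qed.

(** A polynomial relation over the rationals between sr x0 and sc x0 also holds
    between sc x0 and its conjugate; this replaces the 3-cycle of the Galois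
    group.  Over K, the minimal polynomial of x0 factors as q (X - x0) with q
    quadratic.  The image of q under sr has the nonreal root sc x0, so that a
    polynomial D over K whose image vanishes at sc x0 is divisible by q: its
    remainder is linear with real image.  Under sc the roots of q are the two
    conjugates of sc x0 other than sc x0 itself. *)
Lemma conj_transport (D : {poly K}) :
  (map_poly embC D).[sc x0] = 0 -> (map_poly sc D).[(sc x0)^*%C] = 0.
Proof.
move=> hD.
have [p hp] : exists p, minPoly 1 x0 = map_poly (in_alg K) p.
  by have /polyOver1P := minPolyOver 1 x0.
have /factor_theorem[q hq] := root_minPoly 1 x0.
have q0 : q != 0.
  apply: contraTneq (monic_minPoly 1 x0) => q0.
  by rewrite hq q0 mul0r monicE lead_coef0 eq_sym oner_neq0.
have hsq : (size q <= 3)%N.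
  have : (size (minPoly 1 x0) <= 4)%N.
    have := dim_Fadjoin 1%AS x0.
    by rewrite size_minPoly generator_full hdim dimv1 muln1 => <-.
  by rewrite hq size_Mmonic ?monicXsubC // size_XsubC addn2.
have hroot (f : {rmorphism K -> R[i]}) : (map_poly ratr p : {poly R[i]}) =
    map_poly f q * ('X - (f x0)%:P).
  by rewrite -(map_poly_embedding f) -hp hq rmorphM /= map_polyXsubC.
have hp0 : (map_poly ratr p : {poly R[i]}).[sc x0] = 0.
  by rewrite (hroot sc) hornerM hornerXsubC subrr mulr0.
have hp0' : (map_poly ratr p : {poly R[i]}).[(sc x0)^*%C] = 0.
  by rewrite horner_ratr_conj hp0 conjc0.
have hq1 : (map_poly embC q).[sc x0] = 0.
  apply/eqP; move: hp0; rewrite (hroot embC) hornerM hornerXsubC => /eqP.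
  rewrite mulf_eq0 => /orP[//|]; rewrite subr_eq0 => /eqP h.
  by move: hx0; rewrite h /= complex_real eqxx.
have hq2 : (map_poly sc q).[(sc x0)^*%C] = 0.
  apply/eqP; move: hp0'; rewrite (hroot sc) hornerM hornerXsubC => /eqP.
  rewrite mulf_eq0 => /orP[//|]; rewrite subr_eq0.
  move: hx0; case: (sc x0) => a b; rewrite complex_real => hb /eqP[hbb].
  by move: hb; rewrite (_ : b = 0) ?eqxx //; lra.
pose r := D %% q.
have hDr : D = (D %/ q) * q + r by exact: divp_eq.
have hsr : (size r <= 2)%N by rewrite -ltnS (leq_trans _ hsq) // ltn_modp.
have hr : (map_poly embC r).[sc x0] = 0.
  by move: hD; rewrite {1}hDr rmorphD rmorphM hornerD hornerM hq1 mulr0 add0r.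
(* r is r0 + r1 X and sr r0 + sr r1 (sc x0) = 0 with sc x0 not real. *)
have r0 : r = 0.
  have hrE : r = (r`_0)%:P + r`_1 *: 'X.
    apply/polyP => -[|[|j]];
      rewrite coefD coefC coefZ coefX /= ?mulr0 ?mulr1 ?addr0 ?add0r //.
    by rewrite nth_default // (leq_trans hsr).
  move: hr; rewrite {1}hrE rmorphD /= map_polyC map_polyZ map_polyX !hornerE /=.
  move: hx0; case: (sc x0) => a b; rewrite complex_real => hb.
  move=> /eqP; rewrite eq_complex /= => /andP[/eqP h1 /eqP h2].
  have /eqP : sr r`_1 * b = 0 by rewrite -[RHS]h2; ring.
  rewrite mulf_eq0 (negPf hb) orbF fmorph_eq0 => /eqP r1.
  move: h1; rewrite r1 rmorph0 !mul0r subr0 addr0 => /eqP.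
  rewrite fmorph_eq0 => /eqP r0.
  by rewrite hrE r1 r0 scale0r addr0.
by rewrite hDr r0 addr0 rmorphM hornerM hq2 mulr0.
Qed.

(** The Gram determinant, for the complex bilinear form, of the vectors
    [f u_k] and [g u_k]. *)
Definition gram (f g : K -> R[i]) s : R[i] :=
  (\sum_k f (tnth s k) ^+ 2) * (\sum_k g (tnth s k) ^+ 2) -
  (\sum_k f (tnth s k) * g (tnth s k)) ^+ 2.

(** Writing u_k = p_k(x0), the second argument of the Gram determinant becomes
    the value at a conjugate of x0 of a polynomial with coefficients in K, to
    which [conj_transport] applies. *)
Lemma gram_transport s :
  gram embC sc s = 0 -> gram sc (fun u => (sc u)^*%C) s = 0.
Proof.
have /fin_all_exists[p hp] k := generator_poly (tnth s k).
pose P k : {poly K} := map_poly (in_alg K) (p k).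
pose D : {poly K} := (\sum_k (tnth s k)%:P ^+ 2) * (\sum_k P k ^+ 2) -
  (\sum_k (tnth s k)%:P * P k) ^+ 2.
have hP (f : {rmorphism K -> R[i]}) z k :
    (map_poly f (P k)).[z] = (map_poly ratr (p k)).[z].
  by rewrite /P map_poly_embedding.
have hDE (f : {rmorphism K -> R[i]}) (g : K -> R[i]) z :
    (forall k, g (tnth s k) = (map_poly ratr (p k)).[z]) ->
    (map_poly f D).[z] = gram f g s.
  move=> hg; rewrite /D /gram rmorphB rmorphM rmorphXn !rmorph_sum /=.
  rewrite !hornerE !horner_sum; congr (_ * _ - _ ^+ 2); apply: eq_bigr => k _.
  - by rewrite rmorphXn /= map_polyC !hornerE.
  - by rewrite rmorphXn /= horner_exp hP hg.
  - by rewrite rmorphM /= map_polyC hornerM hornerC hP hg.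
have h1 k : sc (tnth s k) = (map_poly ratr (p k)).[sc x0].
  by rewrite {1}hp -horner_map /= map_poly_embedding.
rewrite -(hDE embC sc (sc x0) h1) => /conj_transport.
rewrite (hDE sc (fun u => (sc u)^*%C)) // => k.
by rewrite h1 horner_ratr_conj.
Qed.

(** If z = i then a_perp and b_perp are orthogonal of equal length, i.e. the
    projection of the vector (sc u_k) is isotropic for the complex bilinear
    form; this is the vanishing of the Gram determinant of (sr u_k) and
    (sc u_k). *)
Lemma z_perp_neq_i s :
  xi sr s != 0 -> << s >>%VS = fullv -> z_perp sr sc s != 'i%C.
Proof.
move=> hxi hs; apply/eqP => hz.
set a := a_perp sr sc s in hz; set b := b_perp sr sc s in hz.
have hA : 0 < pair_A a b by exact: pair_A_state_gt0 hx0 hs.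
have hn := pair_A_gt0_norm hA.
move: hz; rewrite /z_perp -/a -/b pair_zE => -[/(canRL (divfK (lt0r_neq0 hn))) h1].
move=> /(canRL (divfK (lt0r_neq0 hn))); rewrite mul0r in h1; rewrite mul1r => h2.
have h3 : dot a a = dot b b.
  have := pair_A_sqr a b; rewrite h1 h2 expr0n subr0 expr2.
  exact: (mulfI (lt0r_neq0 hn)).
set x := xi sr s in hxi; pose u := rvec s; pose v := ivec s.
have hx : dot x x != 0 by apply: contra hxi => /eqP/dot_eq0/eqP.
have haa : dot a a = dot u u - dot u x * dot u x / dot x x.
  by apply: dot_proj_perp.
have hbb : dot b b = dot v v - dot v x * dot v x / dot x x.
  by apply: dot_proj_perp.
have hab : dot a b = dot u v - dot u x * dot v x / dot x x.
  by apply: dot_proj_perp.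
have hsum (f g : K -> R[i]) : \sum_k f (tnth s k) * g (tnth s k) =
    f (tnth s 0) * g (tnth s 0) + f (tnth s 1) * g (tnth s 1) +
    f (tnth s 2) * g (tnth s 2).
  rewrite !big_ord_recl big_ord0 addr0 addrA.
  by congr (_ + f (tnth s _) * g (tnth s _) + f (tnth s _) * g (tnth s _));
    apply/val_inj.
have hsq (f : K -> R[i]) : \sum_k f (tnth s k) ^+ 2 =
   f (tnth s 0) ^+ 2 + f (tnth s 1) ^+ 2 + f (tnth s 2) ^+ 2 := hsum f f.
have E1 : dot x x * (dot u u - dot v v) - (dot u x ^+ 2 - dot v x ^+ 2) = 0.
  transitivity (dot x x * (dot a a - dot b b)); last by rewrite h3 subrr mulr0.
  by rewrite haa hbb; field.
have E2 : dot x x * dot u v - dot u x * dot v x = 0.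
  transitivity (dot x x * dot a b); last by rewrite h1 mulr0.
  by rewrite hab; field.
have hgram : gram embC sc s = 0.
  rewrite /gram !hsq hsum /=.
  move: E1 E2; rewrite !dotE !mxE.
  case: (sc (tnth s 0)) (sc (tnth s 1)) (sc (tnth s 2))
    => [a0 b0] [a1 b1] [a2 b2] /= E1 E2.
  apply/eqP; rewrite eq_complex /=; apply/andP; split; apply/eqP.
    by rewrite -[RHS]E1; ring.
  by rewrite -[RHS](mulr0 2) -[in RHS]E2; ring.
have hfree : 0 < dot u u * dot v v - dot u v ^+ 2.
  apply: dot_gram_gt0 => p q hpq.
  by have [] := @coordinate_vectors_free x0 s 0 p q hx0 hs; rewrite ?scale0r ?add0r.
have := congr1 (@complex.Re R) (gram_transport hgram); rewrite /gram.
rewrite (hsq sc) (hsq (fun u => (sc u)^*%C)) (hsum sc (fun u => (sc u)^*%C)).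
move: hfree; rewrite !dotE !mxE.
case: (sc (tnth s 0)) (sc (tnth s 1)) (sc (tnth s 2))
  => [a0 b0] [a1 b1] [a2 b2] /=.
set G := (X in 0 < X) => hG h.
(* |u.u - v.v + 2 i u.v|^2 - (u.u + v.v)^2 = - 4 (u.u v.v - (u.v)^2) *)
suff : -4 * G = 0 by lra.
by rewrite -[RHS]h /G; ring.
Qed.
End Transport.

(** * Multiplication by units *)

Lemma xi_scale (lam : K) s : xi sr (scale_state lam s) = sr lam *: xi sr s.
Proof. by apply/rowP => k; rewrite !mxE tnth_map rmorphM. Qed.

(** Here [sr lam] may be negative, but the projection only depends on the line
    spanned by [xi sr s]. *)
Lemma proj_perp_scale (lam : K) s v : lam != 0 ->
  proj_perp sr (scale_state lam s) v = proj_perp sr s v.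
Proof.
move=> hlam; have hr : sr lam != 0 by rewrite fmorph_eq0.
rewrite !proj_perpE xi_scale dotC !dotZl [dot (xi sr s) (_ *: _)]dotC dotZl scalerA.
congr (_ - _ *: _); rewrite [dot v _]dotC.
have [->|hx] := eqVneq (dot (xi sr s) (xi sr s)) 0; last by field; rewrite hx hr.
by rewrite !mulr0 !invr0 !mulr0 mul0r.
Qed.

Lemma cvec_perp_scale (lam : K) s : lam != 0 ->
  cvec (a_perp sr sc (scale_state lam s)) (b_perp sr sc (scale_state lam s)) =
  sc lam *: cvec (a_perp sr sc s) (b_perp sr sc s).
Proof.
move=> hlam; apply/cvec_scaleP; rewrite /a_perp /b_perp !proj_perp_scale //.
split; rewrite /proj_perp; move: (xihat sr s) => e;
  apply/rowP => k; rewrite !dotE !mxE !tnth_map !rmorphM;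
  case: (sc lam) (sc (tnth s k)) (sc (tnth s 0)) (sc (tnth s 1)) (sc (tnth s 2))
    => [p q] [a b] [a0 b0] [a1 b1] [a2 b2] /=; ring.
Qed.


End Cubic.

Theorem proposition2p4 (R : realType) (K : fieldExtType rat)
    (sr : {rmorphism K -> R}) (sc : {rmorphism K -> R[i]}) (L : {pred K})
    (hdeg : \dim {:K} = 3%N) (hsig : signature11 sr sc)
    (hL : is_order L) (hLO : forall x, x \in L -> algint x) :
  (* m is the hyperbolic cosine of the distance to i *)
  (forall s : 3.-tuple K, is_state sr L s ->
     upper_half_plane (z_perp sr sc s) /\
     conf_module sr sc s = cosh (hdist (z_perp sr sc s) 'i%C)) /\
  (* the selected candidate minimizes the distance to i *)
  (forall s : 3.-tuple K, is_state sr L s ->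
     (forall t, candidate sr s t -> upper_half_plane (z_perp sr sc t)) /\
     (forall t, selected sr sc s t ->
        candidate sr s t /\
        forall t', candidate sr s t' ->
          hdist (z_perp sr sc t) 'i%C <= hdist (z_perp sr sc t') 'i%C)) /\
  (* action of units *)
  (forall lam : K, algint_unit lam ->
     (forall s : 3.-tuple K, is_state sr L s ->
        cvec (a_perp sr sc (scale_state lam s))
             (b_perp sr sc (scale_state lam s)) =
        sc lam *: cvec (a_perp sr sc s) (b_perp sr sc s)) /\
     (forall theta : R, sc lam = `|sc lam| * expi theta ->
        exists2 g : R[i] -> R[i], elliptic_at_i (2 * theta) g &
          forall s : 3.-tuple K, is_state sr L s ->
            (forall a b : 'rV[R]_3,
               cvec a b = expi theta *: cvec (a_perp sr sc s) (b_perp sr sc s) ->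
               pair_z a b = g (z_perp sr sc s)) /\
            z_perp sr sc (scale_state lam s) = g (z_perp sr sc s)) /\
     (forall s : 3.-tuple K, is_state sr L s ->
        [/\ hdist (z_perp sr sc (scale_state lam s)) 'i%C =
              hdist (z_perp sr sc s) 'i%C,
            conf_module sr sc (scale_state lam s) = conf_module sr sc s
          & z_perp sr sc (scale_state lam s) = z_perp sr sc s <->
              sc lam \is Num.real])).
Proof.
case: hsig => _ [x0 hx0] _.
have span s : is_state sr L s -> << s >>%VS = fullv by case=> _ /andP[/eqP].
have xi_neq0 s : is_state sr L s -> xi sr s != 0.
  by case=> _ _ [_ _]; apply: contraTneq => ->; rewrite mxE ltxx.
have pos s : is_state sr L s -> 0 < pair_A (a_perp sr sc s) (b_perp sr sc s).
  by move=> /span; apply: pair_A_state_gt0 hx0.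
have upper s : is_state sr L s -> upper_half_plane (z_perp sr sc s).
  by move=> /pos hs; apply/pair_z_upper.
have pos_cand s t : is_state sr L s -> candidate sr s t ->
    0 < pair_A (a_perp sr sc t) (b_perp sr sc t).
  by move=> /span hs /(candidate_span hs); apply: pair_A_state_gt0 hx0.
have hi := @upper_half_plane_i R.
split; last split.
- by move=> s hs; split; [exact: upper|exact/conf_moduleE/pos].
- move=> s hs; split=> [t ht|t [ht hmin]].
    exact/pair_z_upper/(pos_cand s).
  split=> [|t' ht']; first exact: ht.
  have hA := pos_cand s t hs ht; have hA' := pos_cand s t' hs ht'.
  apply: hdist_le_cosh; [exact/pair_z_upper|exact/pair_z_upper|exact: hi|].
  by have := hmin t' ht'; rewrite (conf_moduleE hA) (conf_moduleE hA').
move=> lam [hlam _ _].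
have hw : sc lam != 0 by rewrite fmorph_eq0.
have hz s : is_state sr L s ->
    z_perp sr sc (scale_state lam s) = moebius (sc lam) (z_perp sr sc s).
  by move=> hs; exact: (pair_z_moebius hw (pos _ hs) (cvec_perp_scale sr sc s hlam)).
split; [|split].
- by move=> s _; exact: cvec_perp_scale.
- move=> theta htheta; exists (moebius (expi theta)).
    exact: moebius_elliptic.
  move=> s hs; split=> [a b|].
    by apply: pair_z_moebius; [exact: expi_neq0|exact: pos].
  rewrite hz // htheta normc_def moebius_real // gt_eqF //.
  by rewrite sqrtr_gt0 sqr_norm_gt0.
move=> s hs.
have hd : hdist (z_perp sr sc (scale_state lam s)) 'i%C =
          hdist (z_perp sr sc s) 'i%C.
  by rewrite (hz _ hs) -{1}(moebius_i hw); apply: hdist_moebius (upper _ hs) hi.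
split; first exact: hd.
  have hA : 0 < pair_A (a_perp sr sc (scale_state lam s))
                       (b_perp sr sc (scale_state lam s)).
    by apply/pair_z_upper; have := moebius_upper hw (upper _ hs); rewrite -hz.
  by rewrite (conf_moduleE hA) hd -(conf_moduleE (pos _ hs)).
rewrite (hz _ hs); apply: moebius_fixed hw (upper _ hs) _.
by apply: (z_perp_neq_i hx0 hdeg); [exact: xi_neq0|exact: span].
Qed.
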